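(* Let $n,s,r$ be integers with $s>r\ge 1$ and $n>s+r$. Let $\mathcal F\subset\binom{[n]}{2}$ be such that $|F_1\cup\ldots\cup F_s|\le s+r$ for all choices of $F_1,\ldots,F_s\in\mathcal F$. Then $$|\mathcal F|\le\max\big\{|\mathcal A(r,1,n,2)|,\ |\mathcal A(s+r,2,n,2)|\big\}.$$
   Context: For integers $p\ge r\ge 0$, $\mathcal A(p,r,n,k):=\{A\in\binom{[n]}{k}: |A\cap[p]|\ge r\}$, where $\binom{[n]}{k}$ is the set of $k$-subsets of $[n]=\{1,\ldots,n\}$ and $[p]=\{1,\ldots,p\}$. The sets $F_i$ need not be distinct. *)

(* Defs.v *)
From mathcomp Require Export all_boot.

Set Implicit Arguments.
Unset Strict Implicit.
Unset Printing Implicit Defensive.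

(* The ground set [n] = {1, ..., n} is 'I_n, with i : 'I_n standing for i + 1;
   thus [p] is the set of the i : 'I_n with i < p. *)
Definition initseg (n p : nat) : {set 'I_n} := [set i : 'I_n | i < p].

Definition ksets (n k : nat) : {set {set 'I_n}} := [set A : {set 'I_n} | #|A| == k].

Definition frankl_family (p r n k : nat) : {set {set 'I_n}} :=
  [set A in ksets n k | r <= #|A :&: initseg n p|].

(* Main.v *)
Require Import Defs.
From mathcomp Require Import all_fingroup zify.

Set Implicit Arguments.
Unset Strict Implicit.
Unset Printing Implicit Defensive.

(** A matching of size [nu <= s] inside a graph with vertex set [V] extends,
    one new vertex per extra edge, to [s] edges covering [min(|V|, s + nu)]
    vertices.  So either [|V| <= s + r], and the graph lies in a clique on
    [s + r] vertices, or it has no matching of size [r + 1].  In the second case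
    the Erdos-Gallai bound [max(C(2r+1, 2), C(n, 2) - C(n-r, 2))] applies, and
    [2r + 1 <= s + r].  That bound is obtained by shifting: a shifted graph
    without an [(r+1)]-matching misses some pair [{j, 2r+1-j}] with [j <= r]
    (vertices numbered from 0), hence all pairs above it, and the resulting
    bound is convex in [j]. *)

(** Excluding the exact size [r.+1] also excludes larger matchings, since a subset of a matching is
    a matching. *)
Definition matching_free (T : finType) (r : nat) (F : {set {set T}}) : Prop :=
  forall M : {set {set T}}, M \subset F -> trivIset M -> #|M| != r.+1.

(** Termination measure for repeated shifting. *)
Definition weight (n : nat) (A : {set 'I_n}) : nat := \sum_(x in A) x.

(** * The shifting operation *)

Section Shift.

Variables (n : nat) (F : {set {set 'I_n}}) (i j : 'I_n).
Hypothesis lt_ij : i < j.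

Let swap (A : {set 'I_n}) : {set 'I_n} := tperm i j @: A.

(** The classical compression replacing [j] by [i]; a set stays put when its image is already in
    [F], which keeps the map injective on [F]. *)
Definition shift1 (A : {set 'I_n}) : {set 'I_n} :=
  if [&& j \in A, i \notin A & swap A \notin F] then swap A else A.

Definition shift : {set {set 'I_n}} := shift1 @: F.

Lemma mem_swap x (A : {set 'I_n}) : (x \in swap A) = (tperm i j x \in A).
Proof. by rewrite -{1}(tpermK i j x) mem_imset //; apply: perm_inj. Qed.

Lemma swapK : involutive swap.
Proof. by move=> A; apply/setP => x; rewrite !mem_swap tpermK. Qed.

Lemma swap_id (A : {set 'I_n}) : i \notin A -> j \notin A -> swap A = A.
Proof.
move=> iA jA; apply/setP => x; rewrite mem_swap.
by case: tpermP => // ->; rewrite (negPf iA) (negPf jA).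
Qed.

(** A moved set lands outside [F], so it cannot collide with an unmoved one; two moved sets are
    separated by the involution [swap]. *)
Lemma shift1_inj : {in F &, injective shift1}.
Proof.
move=> A B AF BF; rewrite /shift1.
case: ifP => [/and3P[_ _ sA]|_]; case: ifP => [/and3P[_ _ sB]|_] //.
- exact: (can_inj swapK).
- by move=> sAB; rewrite sAB BF in sA.
- by move=> sAB; rewrite -sAB AF in sB.
Qed.

Lemma card_shift : #|shift| = #|F|.
Proof. exact: card_in_imset shift1_inj. Qed.

Lemma card_shift1 (A : {set 'I_n}) : #|shift1 A| = #|A|.
Proof. by rewrite /shift1; case: ifP => // _; apply: card_imset; apply: perm_inj. Qed.

Lemma shift_ksets k : F \subset ksets n k -> shift \subset ksets n k.
Proof.
move=> Fk; apply/subsetP => _ /imsetP[A AF ->].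
by move/subsetP: Fk => /(_ A AF); rewrite !inE card_shift1.
Qed.

Lemma mem_shift (B : {set 'I_n}) : B \in shift ->
  B \in F \/ [/\ i \in B, j \notin B & swap B \in F].
Proof.
case/imsetP => A AF ->; rewrite /shift1; case: ifP => [/and3P[jA iA _]|_]; last by left.
by right; rewrite swapK !mem_swap tpermL tpermR.
Qed.

(** Moved sets contain [i], so [B] was not moved, and only the presence of [swap B] in [F] can have
    blocked the move. *)
Lemma mem_shift_swap (B : {set 'I_n}) :
  B \in shift -> j \in B -> i \notin B -> swap B \in F.
Proof.
case/imsetP => A AF ->; rewrite /shift1; case: ifP => [/and3P[jA iA _]|nc jA iA].
  by rewrite mem_swap tpermR (negPf iA).
by move: nc; rewrite jA iA /= => /negbFE.
Qed.

(* At most one edge [B] of a matching in the shifted family is new; if there is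
   one, swapping [i] and [j] maps the whole matching into [F]. *)
Lemma matching_free_shift r : matching_free r F -> matching_free r shift.
Proof.
move=> mfF M Msub Mtriv.
have [MF|/subsetPn[B BM BnF]] := boolP (M \subset F); first exact: mfF.
have [BF|[iB jB sB]] := mem_shift (subsetP Msub B BM); first by rewrite BF in BnF.
have swinj : injective swap := can_inj swapK.
rewrite -(card_imset (mem M) swinj); apply: mfF.
  apply/subsetP => _ /imsetP[C CM ->].
  have [-> //|neCB] := eqVneq C B.
  have iC : i \notin C.
    apply: contra neCB => iC; apply/eqP.
    by rewrite -(def_pblock Mtriv CM iC) (def_pblock Mtriv BM iB).
  have Csh := subsetP Msub C CM.
  have [jC|jC] := boolP (j \in C); first exact: mem_shift_swap.
  by rewrite swap_id //; case: (mem_shift Csh) => // -[]; rewrite (negPf iC).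
apply/trivIsetP => _ _ /imsetP[C CM ->] /imsetP[D DM ->] neCD.
rewrite -setI_eq0 -(imsetI (in2W perm_inj)) imset_eq0 setI_eq0.
by apply: (trivIsetP Mtriv) => //; apply: contraNneq neCD => ->.
Qed.

Lemma weight_swap (A : {set 'I_n}) :
  j \in A -> i \notin A -> weight (swap A) < weight A.
Proof.
move=> jA iA; rewrite /weight big_imset /=; last by move=> x y _ _; apply: perm_inj.
rewrite [ltnRHS](bigD1 j) //= (bigD1 j) //= tpermR -addSn leq_add //.
rewrite leq_eqVlt; apply/orP; left; apply/eqP; apply: eq_bigr => x /andP[xA xj].
by case: tpermP => // xi; [rewrite -xi xA in iA | rewrite xi eqxx in xj].
Qed.

Lemma weight_shift1 (A : {set 'I_n}) : weight (shift1 A) <= weight A.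
Proof.
by rewrite /shift1; case: ifP => // /and3P[jA iA _]; apply/ltnW/weight_swap.
Qed.

Lemma weight_shift (A : {set 'I_n}) :
    A \in F -> j \in A -> i \notin A -> swap A \notin F ->
  \sum_(B in shift) weight B < \sum_(B in F) weight B.
Proof.
move=> AF jA iA sA; rewrite big_imset /=; last exact: shift1_inj.
rewrite [ltnRHS](bigD1 A) //= (bigD1 A) //= -addSn leq_add //.
  by rewrite /shift1 jA iA sA weight_swap.
by apply: leq_sum => B _; apply: weight_shift1.
Qed.

End Shift.

(** * Shifted families *)

Definition shifted (n : nat) (F : {set {set 'I_n}}) : Prop :=
  forall (A : {set 'I_n}) (i j : 'I_n), A \in F -> i < j -> j \in A -> i \notin A ->
    tperm i j @: A \in F.

(** Induction on the total weight: every shift that changes the family lowers it strictly. *)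
Lemma exists_shifted (n k r : nat) (F : {set {set 'I_n}}) :
    F \subset ksets n k -> matching_free r F ->
  exists E : {set {set 'I_n}},
    [/\ E \subset ksets n k, matching_free r E, shifted E & #|E| = #|F|].
Proof.
have [m] := ubnP (\sum_(B in F) weight B).
elim: m F => // m IHm F ltm Fk mfF.
have [/existsP[A /existsP[i /existsP[j]]]|nsh] := boolP
    [exists A : {set 'I_n}, exists i : 'I_n, exists j : 'I_n,
       [&& A \in F, i < j, j \in A, i \notin A & tperm i j @: A \notin F]].
  case/and5P => AF ij jA iA sA.
  have [||//|E [Ek mfE shE cE]] := IHm (shift F i j).
  - exact: leq_trans (weight_shift ij AF jA iA sA) ltm.
  - exact: shift_ksets.
  - exact: matching_free_shift.
  by exists E; split=> //; rewrite cE card_shift.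
exists F; split=> // A i j AF ij jA iA; apply: contraNT nsh => sA.
by apply/existsP; exists A; apply/existsP; exists i; apply/existsP; exists j; apply/and5P.
Qed.

Lemma tperm_set2l (T : finType) (a b c : T) :
  b != a -> b != c -> tperm c a @: [set a; b] = [set c; b].
Proof. by move=> ba bc; rewrite imsetU1 imset_set1 tpermR tpermD // eq_sym. Qed.

(** The smaller endpoint is lowered first: [c] stays below both [b] and [d], whereas lowering [b]
    first could run into [a]. *)
Lemma shifted_pair (n : nat) (F : {set {set 'I_n}}) (a b c d : 'I_n) :
  shifted F -> [set a; b] \in F -> a < b -> c < d -> c <= a -> d <= b ->
  [set c; d] \in F.
Proof.
move=> shF abF ab cd ca db.
have cbF : [set c; b] \in F.
  move: ca; rewrite leq_eqVlt => /predU1P[/val_inj-> //|ca].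
  have /(_ _ _ _ abF ca) := shF; rewrite !inE -!val_eqE /= eqxx => /(_ isT).
  rewrite tperm_set2l -?val_eqE /=; [|lia|lia].
  by apply; lia.
move: db; rewrite leq_eqVlt => /predU1P[/val_inj-> //|db].
have /(_ _ _ _ cbF db) := shF; rewrite !inE -!val_eqE /= eqxx orbT => /(_ isT).
rewrite [[set c; b]]setUC tperm_set2l -?val_eqE /=; [|lia|lia].
by rewrite setUC; apply; lia.
Qed.

(** * Sizes of initial segments and of the two extremal families *)

Lemma card_initseg (n p : nat) : p <= n -> #|initseg n p| = p.
Proof.
move=> pn; rewrite -[RHS](card_ord p) -cardsT.
have winj : injective (widen_ord pn) by move=> x y /(congr1 val) xy; apply: val_inj.
rewrite -(card_imset _ winj).
apply: eq_card => x; rewrite inE; apply/idP/imsetP => [xp|[y _ ->]]; last exact: (ltn_ord y).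
by exists (Ordinal xp) => //; apply: val_inj.
Qed.

Lemma card_initsegD (n p q : nat) : q <= n -> #|initseg n q :\: initseg n p| = q - p.
Proof.
move=> qn; have [pq|qp] := leqP p q.
  rewrite cardsD (_ : _ :&: _ = initseg n p) ?card_initseg //; first exact: leq_trans pq qn.
  by apply/setP => x; rewrite !inE; lia.
rewrite (_ : _ :\: _ = set0) ?cards0; first lia.
by apply/setP => x; rewrite !inE; lia.
Qed.

Lemma card_ksets (n k : nat) : #|ksets n k| = 'C(n, k).
Proof. by rewrite card_draws card_ord. Qed.

Lemma card_frankl_clique (n p k : nat) : p <= n -> #|frankl_family p k n k| = 'C(p, k).
Proof.
move=> pn; rewrite -[in RHS](card_initseg pn) -cards_draws.
apply: eq_card => A; rewrite !inE andbC; apply: andb_id2r => /eqP <-.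
apply/idP/idP => [le|/setIidPl-> //].
by apply/setIidPl/eqP; rewrite eqEcard subsetIl.
Qed.

(** The [k]-sets outside the family are those of the complement of the initial segment. The additive
    form avoids truncated subtraction. *)
Lemma card_frankl_star (n p k : nat) :
  p <= n -> #|frankl_family p 1 n k| + 'C(n - p, k) = 'C(n, k).
Proof.
move=> pn; rewrite -[RHS]card_ksets -[RHS](cardsID (frankl_family p 1 n k)); congr (_ + _).
  by apply: eq_card => A; rewrite !inE; case: (_ == _).
have -> : n - p = #|~: initseg n p| by rewrite cardsCs setCK card_initseg ?card_ord.
rewrite -cards_draws; apply: eq_card => A; rewrite !inE.
case: (_ == k); rewrite ?andbF //= !andbT lt0n negbK cards_eq0 setI_eq0.
by rewrite disjoints_subset.
Qed.

(** * The Erdos-Gallai bound *)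

Lemma set2_ordP (n : nat) (A : {set 'I_n}) :
  #|A| = 2 -> exists a b : 'I_n, a < b /\ A = [set a; b].
Proof.
move/eqP/cards2P=> [a [b [nab ->]]].
have [ab|ba] := leqP b a; last by exists a, b.
exists b, a; rewrite setUC; split=> //.
by rewrite ltn_neqAle ab andbT eq_sym.
Qed.

(** The [r.+1] pairs with sum [r.*2.+1] are disjoint, so they would form a forbidden matching if all
    were in [F]. *)
Lemma matching_free_missing_pair (n r : nat) (F : {set {set 'I_n}}) :
    r.*2.+1 < n -> matching_free r F ->
  exists c d : 'I_n, [/\ c <= r, c + d = r.*2.+1 & [set c; d] \notin F].
Proof.
move=> rn mfF.
have cP (k : 'I_r.+1) : k < n by have := ltn_ord k; lia.
have dP (k : 'I_r.+1) : r.*2.+1 - k < n by lia.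
pose e k := [set Ordinal (cP k); Ordinal (dP k)].
have memeP k (x : 'I_n) : x \in e k -> x = k :> nat \/ x = r.*2.+1 - k :> nat.
  by rewrite !inE => /orP[] /eqP ->; [left | right].
have common k l x : x \in e k -> x \in e l -> k = l.
  move=> /memeP xk /memeP xl; apply: val_inj => /=.
  have := ltn_ord k; have := ltn_ord l; lia.
have [/forallP eF|/forallPn[k ekF]] := boolP [forall k, e k \in F]; last first.
  exists (Ordinal (cP k)), (Ordinal (dP k)); split=> //=; have := ltn_ord k; lia.
have e_inj : injective e.
  move=> k l ekl; apply: (@common _ _ (Ordinal (cP k))); last rewrite -ekl;
    by rewrite !inE eqxx.
have /negP[] : #|e @: setT| != r.+1.
  apply: mfF; first by apply/subsetP => _ /imsetP[k _ ->].
  apply/trivIsetP => _ _ /imsetP[k _ ->] /imsetP[l _ ->] nkl.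
  rewrite -setI_eq0; apply: contraNT nkl => /set0Pn[x] /setIP[xk xl].
  by rewrite (common _ _ _ xk xl).
by rewrite card_imset // cardsT card_ord.
Qed.

(** The function 'C(n, 2) - 'C(n - j, 2) + 'C(2r + 1 - 2j, 2) is a convex quadratic in [j], hence at
    most the larger of its values at [j = r] and [j = 0]. *)
Lemma bin2_convex (n r j : nat) : j <= r -> r.*2.+1 < n ->
  'C(n, 2) + 'C(r.*2.+1 - j.*2, 2) <=
    'C(n - j, 2) + maxn ('C(n, 2) - 'C(n - r, 2)) 'C(r.*2.+1, 2).
Proof.
have dbl m : 'C(m, 2) * 2 = m * m.-1.
  by rewrite bin2 muln2 -[RHS]odd_double_half oddM; case: m => //= m; rewrite andNb.
move=> jr rn; have [t rE] : exists t, r = j + t by exists (r - j); lia.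
have [m nE] : exists m, n = m.+1 + r by exists (n - r).-1; lia.
move: (dbl n) (dbl (r.*2.+1 - j.*2)) (dbl (n - j)) (dbl (n - r)) (dbl r.*2.+1).
have -> : r.*2.+1 - j.*2 = (2 * t).+1 by lia.
have -> : n - j = (m + t).+1 by lia.
have -> : n - r = m.+1 by lia.
have -> : r.*2.+1 = (2 * (j + t)).+1 by lia.
have -> : n = (m + j + t).+1 by lia.
rewrite /=; move: 'C(_, 2) 'C(_, 2) 'C(_, 2) 'C(_, 2) 'C(_, 2) => b1 b2 b3 b4 b5.
(* Doubled, the values at [r] and at 0 exceed the one at [j] by t(2m - 3t - 1) and j(3j + 6t + 1 -
   2m) respectively; the test is the sign of the first. *)
move=> e1 e2 e3 e4 e5; have [large|small] := leqP (3 * t + 1) (2 * m).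
  apply: leq_trans (leq_add (leqnn _) (leq_maxl _ _)).
  have := leq_mul (leqnn t) large; lia.
apply: leq_trans (leq_add (leqnn _) (leq_maxr _ _)).
have /(leq_mul (leqnn j)) : 2 * m <= 3 * j + 6 * t + 1 by lia.
lia.
Qed.

Lemma erdos_gallai (n r : nat) (F : {set {set 'I_n}}) :
    r.*2.+1 < n -> F \subset ksets n 2 -> matching_free r F ->
  #|F| <= maxn ('C(n, 2) - 'C(n - r, 2)) 'C(r.*2.+1, 2).
Proof.
move=> rn F2 mfF.
have [E [E2 mfE shE <-]] := exists_shifted F2 mfF.
have [c [d [cr cd cdE]]] := matching_free_missing_pair rn mfE.
have cltd : c < d by lia.
(* An edge with smaller end at least [c] and larger end at least [d] would shift down to the missing
   pair; so each edge meets the first [c] vertices or lies in [K]. *)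
pose K := [set A : {set 'I_n} | A \subset initseg n d :\: initseg n c & #|A| == 2].
have EK : E \subset frankl_family c 1 n 2 :|: K.
  apply/subsetP => A AE; have := subsetP E2 A AE; rewrite inE => A2.
  have [a [b [ab AE']]] := set2_ordP (eqP A2).
  rewrite !inE A2 /= andbT -implyNb; apply/implyP.
  rewrite -leqNgt leqn0 cards_eq0 setI_eq0 => disjA.
  have ca : c <= a.
    rewrite leqNgt; apply/negP => ac; move/pred0P: disjA => /(_ a).
    by rewrite /= AE' !inE eqxx ac.
  have bd : b < d.
    rewrite ltnNge; apply: contra cdE => db.
    by apply: (shifted_pair shE _ ab cltd ca db); rewrite -AE'.
  by apply/subsetP => x; rewrite AE' !inE => /orP[] /eqP ->; lia.
have cn : c <= n by lia.
have := bin2_convex cr rn; have := card_frankl_star 2 cn.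
have := subset_leq_card EK; have := leq_card_setU (frankl_family c 1 n 2) K.
case=> + _; rewrite [#|K|]cards_draws card_initsegD ?(ltnW (ltn_ord d)) //.
rewrite (_ : d - c = r.*2.+1 - c.*2); last lia.
lia.
Qed.

(** * Extending a matching to edges with a large union *)

Section CoverExtension.

Variables (T : finType) (F M : {set {set T}}) (r s : nat).
Hypothesis F2 : forall A, A \in F -> #|A| = 2.
Hypotheses (MF : M \subset F) (Mtriv : trivIset M) (cardM : #|M| = r.+1).
Hypothesis coverF : s + r < #|cover F|.

(** At [k = r.+1] the matching itself covers 2r + 2 = k + r + 1 vertices; each further edge gains at
    least one vertex while some vertex of [cover F] is missed. *)
Lemma matching_extension k : r < k <= s ->
  exists t : seq {set T},
    [/\ size t = k, {subset t <= F} & k + r < #|\bigcup_(A <- t) A|].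
Proof.
case/andP; elim: k => // k IHk; rewrite ltnS leq_eqVlt => /predU1P[<- _|rk ks].
  exists (enum M); split; first by rewrite -cardE.
    by move=> A; rewrite mem_enum => /(subsetP MF).
  rewrite big_enum /=; have /eqP := Mtriv; rewrite /cover => <-.
  rewrite (eq_bigr (fun=> 2)) => [|A AM]; last exact: F2 (subsetP MF A AM).
  by rewrite sum_nat_const cardM; lia.
have [t [tk tF tc]] := IHk rk (ltnW ks).
have [/subset_leq_card le|/subsetPn[x /bigcupP[A AF xA] xt]] :=
    boolP (cover F \subset \bigcup_(A <- t) A).
  (* All of [cover F] is reached, which is already enough vertices: any edge serves as padding, as
     repetitions are allowed. *)
  have /card_gt0P[A AM] : 0 < #|M| by rewrite cardM.
  exists (A :: t); split=> [|B|]; first by rewrite /= tk.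
    by rewrite inE => /predU1P[->|/tF//]; apply: (subsetP MF).
  rewrite big_cons; apply: leq_trans (subset_leq_card (subsetUr _ _)); lia.
exists (A :: t); split=> [|B|]; first by rewrite /= tk.
  by rewrite inE => /predU1P[->|/tF].
rewrite big_cons; set U := \bigcup_(B <- t) B in tc xt *.
have : #|x |: U| <= #|A :|: U| by apply/subset_leq_card/setSU; rewrite sub1set.
rewrite cardsU1 xt; lia.
Qed.

End CoverExtension.

Theorem theorem5 (n s r : nat) (r_ge1 : 1 <= r) (r_lt_s : r < s)
    (n_gt : s + r < n) (F : {set {set 'I_n}}) (F_sub : F \subset ksets n 2)
    (F_union : forall G : 'I_s -> {set 'I_n},
        (forall i, G i \in F) -> #|\bigcup_(i < s) G i| <= s + r) :
  #|F| <= maxn #|frankl_family r 1 n 2| #|frankl_family (s + r) 2 n 2|.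
Proof.
have F2 A : A \in F -> #|A| = 2.
  by move/(subsetP F_sub); rewrite inE => /eqP.
rewrite (card_frankl_clique 2 (ltnW n_gt)).
have [small|large] := leqP #|cover F| (s + r).
  apply: leq_trans (leq_maxr _ _); apply: leq_trans (leq_bin2l 2 small).
  rewrite -cards_draws; apply/subset_leq_card/subsetP => A AF.
  by rewrite inE (F2 A AF) eqxx andbT; apply: bigcup_sup.
have mfF : matching_free r F.
  move=> M MF Mtriv; apply/eqP => cardM.
  have rss : r < s <= s by rewrite r_lt_s leqnn.
  have [t [ts tF]] := matching_extension F2 MF Mtriv cardM large rss.
  (* The list becomes a family indexed by ['I_s]; the default [set0] is never reached because [t]
     has size [s]. *)
  rewrite (big_nth set0) ts big_mkord ltnNge => /negP[]; apply: F_union => i.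
  by apply/tF/mem_nth; rewrite ts.
have rn : r.*2.+1 < n by lia.
have := erdos_gallai rn F_sub mfF.
have := card_frankl_star (n := n) (p := r) 2 ltac:(lia).
have : 'C(r.*2.+1, 2) <= 'C(s + r, 2) by apply: leq_bin2l; lia.
lia.
Qed.
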